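(* There exists a universal constant $C>0$ such that the following holds. Let $\mu=\gamma$ be the standard Gaussian measure on $\mathbb{R}^d$, let $\nu$ be the normalized Lebesgue measure on a convex set $\Omega\subset\mathbb{R}^d$ with diameter $D$, let $\nabla\Phi$ be the optimal transportation mapping pushing $\mu$ forward onto $\nu$, and let $M$ be $\mathbb{R}^d$ equipped with the Riemannian metric $g=D^2\Phi$. Assume, in addition, that $M$ is geodesically convex. Then $$\mathrm{diam}(M)\le C\,\sqrt[4]{d}\,\sqrt{D},$$ where $\mathrm{diam}(M)$ is the diameter of $M$ with respect to the Riemannian distance $d_M$.
   Context: $\Phi$ is the convex potential of the optimal transport map (smooth on $\mathbb{R}^d$ with positive definite Hessian), and $g_{ij}=\partial_{x_i}\partial_{x_j}\Phi$ in standard coordinates. A smooth (possibly non-complete) Riemannian manifold $M$ is called geodesically convex if every two points $x,y\in M$ can be joined by a smooth geodesic path in $M$ which is a shortest path from $x$ to $y$. ''Universal'' means independent of $d$, $\Omega$ and $D$. *)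

(* Defs.v *)
From HB Require Import structures.
From mathcomp Require Import all_boot all_order all_algebra.
From mathcomp Require Import all_classical all_reals all_analysis.
From mathcomp Require Import measurable_realfun.

Set Implicit Arguments.
Unset Strict Implicit.
Unset Printing Implicit Defensive.

Import Order.TTheory GRing.Theory Num.Theory.
Import numFieldNormedType.Exports.

Local Open Scope ring_scope.
Local Open Scope classical_set_scope.

(* Same sigma-algebra as the library's n.-tuple T: generated by the
   coordinates. *)
Section measurable_row.
Context {d : measure_display} {T : measurableType d}.
Variable n : nat.

Let coord : 'I_n -> 'rV[T]_n -> T := fun i x => x ord0 i.

Let row_set0 : g_sigma_preimage coord set0.
Proof. exact: sigma_algebra0. Qed.

Let row_setC A : g_sigma_preimage coord A -> g_sigma_preimage coord (~` A).
Proof. exact: sigma_algebraC. Qed.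

Let row_bigcup (F : (set 'rV[T]_n)^nat) :
  (forall i, g_sigma_preimage coord (F i)) ->
  g_sigma_preimage coord (\bigcup_i (F i)).
Proof. exact: sigma_algebra_bigcup. Qed.

HB.instance Definition _ := @isMeasurable.Build (measure_tuple_display d)
  'rV[T]_n (g_sigma_preimage coord) row_set0 row_setC row_bigcup.

End measurable_row.

Lemma measurable_coord d (T : measurableType d) n (i : 'I_n) :
  measurable_fun [set: 'rV[T]_n] (fun x => x ord0 i).
Proof.
move=> _ Y mY; rewrite setTI; apply: sub_sigma_algebra => /=.
rewrite -bigcup_seq/=; exists i => /=; first by rewrite mem_index_enum.
by exists Y => //; rewrite setTI.
Qed.

Lemma measurable_fun_row d1 d2 (T1 : measurableType d1)
    (T2 : measurableType d2) n (f : T1 -> 'rV[T2]_n) :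
  (forall i, measurable_fun [set: T1] (fun x => f x ord0 i)) ->
  measurable_fun [set: T1] f.
Proof.
move=> mf.
have H : g_sigma_preimage (fun i x => f x ord0 i) `<=` measurable.
  apply: smallest_sub; first exact: sigma_algebra_measurable.
  case: n => [|n] in f mf *; first by rewrite big_ord0.
  rewrite -bigcup_mkord_ord; apply: bigcup_sub => i Ii.
  by move=> A [B mB <-]; exact: mf.
move=> _ A mA; apply: H.
have := g_sigma_preimage_comp (fun (i : 'I_n) (x : 'rV[T2]_n) => x ord0 i) f.
by rewrite /comp => ->; exists A.
Qed.

Section lebesgue_row.
Context {R : realType}.

Definition rV_cons n (p : measurableTypeR R * 'rV[R]_n) : 'rV[R]_n.+1 :=
  @row_mx R 1 1 n (const_mx p.1) p.2.

Definition rV_uncons n (x : 'rV[R]_n.+1) : measurableTypeR R * 'rV[R]_n :=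
  (x ord0 ord0, @rsubmx R 1 1 n x).

Lemma rV_consK n : cancel (@rV_cons n) (@rV_uncons n).
Proof.
move=> [a v]; rewrite /rV_cons /rV_uncons /= row_mxKr; congr pair.
rewrite (_ : ord0 = lshift n (ord0 : 'I_1)); last exact: val_inj.
by rewrite (@row_mxEl _ 1 1 n) mxE.
Qed.

Lemma measurable_rV_cons n : measurable_fun setT (@rV_cons n).
Proof.
apply: measurable_fun_row => i.
case: (@split_ordP 1 n i) => j ->.
  rewrite (_ : (fun x => _) = fst) //; apply/funext => -[a v].
  by rewrite /rV_cons (@row_mxEl _ 1 1 n) mxE.
rewrite (_ : (fun x => _) = (fun v : 'rV[R]_n => v ord0 j) \o snd).
  by apply: measurableT_comp => //; exact: measurable_coord.
by apply/funext => -[a v]; rewrite /rV_cons (@row_mxEr _ 1 1 n).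
Qed.

Lemma measurable_rV_uncons n : measurable_fun setT (@rV_uncons n).
Proof.
apply/measurable_fun_pair; first exact: (@measurable_coord _ R).
apply: measurable_fun_row => i.
rewrite (_ : (fun x => _) = fun x : 'rV[R]_n.+1 => x ord0 (rshift 1 i)).
  exact: measurable_coord.
by apply/funext => x; rewrite mxE.
Qed.

Section cons_measure.
Local Open Scope ereal_scope.
Variables (n : nat) (m : {sigma_finite_measure set 'rV[R]_n -> \bar R}).

Definition cons_measure : set 'rV[R]_n.+1 -> \bar R :=
  pushforward (lebesgue_measure \x m) (@rV_cons n).

Let mcons A : measurable A -> measurable (@rV_cons n @^-1` A).
Proof.
by move=> mA; rewrite -[X in measurable X]setTI; exact: measurable_rV_cons.
Qed.

Let cons_measure0 : cons_measure set0 = 0.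
Proof. by rewrite /cons_measure /pushforward preimage_set0 measure0. Qed.

Let cons_measure_ge0 A : 0 <= cons_measure A.
Proof. exact: (measure_ge0 (lebesgue_measure \x m)). Qed.

Let cons_measure_sigma_additive : semi_sigma_additive cons_measure.
Proof.
move=> F mF tF mUF; rewrite /cons_measure /pushforward preimage_bigcup.
apply: measure_semi_sigma_additive.
- by move=> i; exact: mcons.
- apply/trivIsetP => /= i j _ _ ij; rewrite -preimage_setI.
  by move/trivIsetP : tF => /(_ _ _ _ _ ij) ->//; rewrite preimage_set0.
- by rewrite -preimage_bigcup; exact: mcons.
Qed.

HB.instance Definition _ := isMeasure.Build _ _ _
  cons_measure cons_measure0 cons_measure_ge0 cons_measure_sigma_additive.

Let cons_measure_sigma_finite : sigma_finite setT cons_measure.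
Proof.
have /sigma_finiteP[F [TF ndF Foo]] := sigma_finiteT (@lebesgue_measure R).
have /sigma_finiteP[G [TG ndG Goo]] := sigma_finiteT m.
exists (fun k => @rV_uncons n @^-1` (F k `*` G k)).
  rewrite -preimage_bigcup -[LHS](@preimage_setT _ _ (@rV_uncons n)).
  congr (_ @^-1` _); rewrite -setXTT TF TG predeqE => -[x y]; split.
    move=> [/= [i _ Fix] [k _ Gky]]; exists (maxn i k) => //; split.
    - by move: x Fix; exact/subsetPset/ndF/leq_maxl.
    - by move: y Gky; exact/subsetPset/ndG/leq_maxr.
  by move=> [k _ []/= ? ?]; split; exists k.
move=> k; have [mF ?] := Foo k; have [mG ?] := Goo k; split.
  rewrite -[X in measurable X]setTI.
  by apply: measurable_rV_uncons => //; exact: measurableX.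
rewrite /cons_measure /pushforward -comp_preimage.
rewrite (_ : _ \o _ = id); last by apply/funext => x /=; rewrite rV_consK.
by rewrite preimage_id product_measure1E// lte_mul_pinfty// ge0_fin_numE.
Qed.

HB.instance Definition _ :=
  Measure_isSigmaFinite.Build _ _ _ cons_measure cons_measure_sigma_finite.

End cons_measure.

(* Lebesgue measure on R^n as an iterated product; on R^0 it is the unit mass
   at the only point. *)
Fixpoint lebesgue_row n : {sigma_finite_measure set 'rV[R]_n -> \bar R} :=
  if n is n'.+1 then cons_measure (lebesgue_row n') else \d_(0 : 'rV[R]_0).

End lebesgue_row.

Section euclidean.
Context {R : realType} {d : nat}.
Implicit Types x y : 'rV[R]_d.

(* The library norm of 'rV[R]_d is the sup norm. *)
Definition enorm x : R := Num.sqrt (\sum_(i < d) x ord0 i ^+ 2).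

Definition euclid_dist x y : \bar R := (enorm (x - y))%:E.

Lemma enorm_sqr x : enorm x ^+ 2 = \sum_(i < d) x ord0 i ^+ 2.
Proof. by rewrite sqr_sqrtr// sumr_ge0// => i _; exact: sqr_ge0. Qed.

Lemma measurable_enorm_sqr : measurable_fun setT (fun x => enorm x ^+ 2).
Proof.
under eq_fun do rewrite enorm_sqr.
apply: measurable_sum => i; apply: measurable_funX.
exact: (@measurable_coord _ R).
Qed.

End euclidean.

Definition diameter {R : realType} {T : Type} (dist : T -> T -> \bar R)
    (A : set T) : \bar R :=
  ereal_sup [set dist x y | x in A & y in A].

Section probability_measures.
Context {R : realType} {d : nat}.
Local Open Scope ereal_scope.

Definition gaussian_density (x : 'rV[R]_d) : R :=
  (2 * pi) `^ (- (d%:R / 2)) * expR (- (enorm x ^+ 2 / 2)).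

Lemma gaussian_density_ge0 x : (0 <= gaussian_density x)%R.
Proof. by rewrite mulr_ge0 ?powR_ge0 ?expR_ge0. Qed.

Lemma measurable_gaussian_density : measurable_fun setT gaussian_density.
Proof.
apply: measurable_funM => //; apply: measurableT_comp => //.
apply: measurableT_comp => //; apply: measurable_funM => //.
exact: measurable_enorm_sqr.
Qed.

Definition gaussian_measure (A : set 'rV[R]_d) : \bar R :=
  \int[lebesgue_row d]_(x in A) (gaussian_density x)%:E.

Let gaussian0 : gaussian_measure set0 = 0.
Proof. by rewrite /gaussian_measure integral_set0. Qed.

Let gaussian_ge0 A : 0 <= gaussian_measure A.
Proof.
by apply: integral_ge0 => x _; rewrite lee_fin gaussian_density_ge0.
Qed.

Let gaussian_sigma_additive : semi_sigma_additive gaussian_measure.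
Proof.
move=> F mF tF mUF; rewrite /gaussian_measure ge0_integral_bigcup//.
- apply: is_cvg_ereal_nneg_natsum => k _.
  by apply: integral_ge0 => x _; rewrite lee_fin gaussian_density_ge0.
- apply: measurable_funTS; apply/measurable_EFinP.
  exact: measurable_gaussian_density.
- by move=> x _; rewrite lee_fin gaussian_density_ge0.
Qed.

HB.instance Definition _ := isMeasure.Build _ _ _ gaussian_measure
  gaussian0 gaussian_ge0 gaussian_sigma_additive.

(* Lebesgue outer measure: a convex set is Lebesgue measurable but need not
   be Borel, and [lebesgue_row] only makes sense on Borel sets. *)
Definition volume (A : set 'rV[R]_d) : \bar R := mu_ext (lebesgue_row d) A.

Definition uniform_measure (Omega A : set 'rV[R]_d) : \bar R :=
  volume (A `&` Omega) / volume Omega.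

Definition transport_map (mu nu : set 'rV[R]_d -> \bar R)
    (S : 'rV[R]_d -> 'rV[R]_d) :=
  measurable_fun setT S /\ forall A, measurable A -> mu (S @^-1` A) = nu A.

Definition transport_cost (mu : set 'rV[R]_d -> \bar R)
    (S : 'rV[R]_d -> 'rV[R]_d) : \bar R :=
  \int[mu]_x ((enorm (x - S x) ^+ 2)%R)%:E.

Definition optimal_transport_map (mu nu : set 'rV[R]_d -> \bar R)
    (S : 'rV[R]_d -> 'rV[R]_d) :=
  transport_map mu nu S /\
  forall S', transport_map mu nu S' ->
    transport_cost mu S <= transport_cost mu S'.

End probability_measures.

Section calculus.
Context {R : realType} {d : nat}.

Definition partial (i : 'I_d) (f : 'rV[R]_d -> R) : 'rV[R]_d -> R :=
  fun x => 'D_(delta_mx ord0 i) f x.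

Definition iter_partial (s : seq 'I_d) (f : 'rV[R]_d -> R) : 'rV[R]_d -> R :=
  foldr partial f s.

Definition smooth (f : 'rV[R]_d -> R) := forall s : seq 'I_d,
  continuous (iter_partial s f) /\
  forall (i : 'I_d) x, derivable (iter_partial s f) x (delta_mx ord0 i).

Definition gradient (f : 'rV[R]_d -> R) (x : 'rV[R]_d) : 'rV[R]_d :=
  \row_i partial i f x.

Definition hessian (f : 'rV[R]_d -> R) (x : 'rV[R]_d) : 'M[R]_d :=
  \matrix_(i, j) partial i (partial j f) x.

Definition quad (A : 'M[R]_d) (v : 'rV[R]_d) : R :=
  (v *m A *m v^T) ord0 ord0.

Definition posdef (A : 'M[R]_d) := forall v, v != 0 -> 0 < quad A v.

Definition smooth_curve (c : R -> 'rV[R]_d) :=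
  forall n t, derivable (c^`(n)%classic) t 1.

End calculus.

(* A Riemannian metric on R^d is given by its matrix in the standard
   coordinates. *)
Section riemannian.
Context {R : realType} {d : nat}.
Variable g : 'rV[R]_d -> 'M[R]_d.

(* Each piece is the restriction of a smooth curve to a closed interval of
   the partition 0 = t_0 < ... < t_k = 1 with s = [:: t_1; ...; t_k]. *)
Definition piecewise_smooth_path (c : R -> 'rV[R]_d) :=
  exists s : seq R, itv_partition 0 1 s /\
    forall k, (k < size s)%N -> exists2 b : R -> 'rV[R]_d,
      smooth_curve b &
      {in `[nth 0 (0 :: s) k, nth 0 (0 :: s) k.+1], c =1 b}.

(* The value of the derivative at the break points is irrelevant. *)
Definition path_length (c : R -> 'rV[R]_d) : \bar R :=
  (\int[lebesgue_measure]_(t in `[0%R, 1%R])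
     (Num.sqrt (quad (g (c t)) (c^`()%classic t)))%:E)%E.

Definition riem_dist (x y : 'rV[R]_d) : \bar R :=
  ereal_inf [set path_length c | c in
    [set c | [/\ piecewise_smooth_path c, c 0 = x & c 1 = y]]].

Definition christoffel (k i j : 'I_d) (x : 'rV[R]_d) : R :=
  2^-1 * \sum_(l < d) invmx (g x) k l *
    (partial i (fun z => g z j l) x + partial j (fun z => g z i l) x
     - partial l (fun z => g z i j) x).

(* A geodesic path is parametrized by [0, 1] only; extending it smoothly to
   the whole line is no restriction. *)
Definition geodesic_path (c : R -> 'rV[R]_d) :=
  smooth_curve c /\
  forall t, 0 <= t <= 1 -> forall k : 'I_d,
    c^`(2)%classic t ord0 k +
    \sum_(i < d) \sum_(j < d) christoffel k i j (c t) *
      c^`()%classic t ord0 i * c^`()%classic t ord0 j = 0.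

Definition geodesically_convex := forall x y : 'rV[R]_d,
  exists c : R -> 'rV[R]_d,
    [/\ geodesic_path c, c 0 = x, c 1 = y & path_length c = riem_dist x y].

Definition riem_diam : \bar R := diameter riem_dist setT.

End riemannian.

(* Main.v *)
Require Import Defs.
From mathcomp Require Import all_boot all_order all_algebra.
From mathcomp Require Import all_classical all_reals all_analysis.
From mathcomp Require Import measurable_realfun ring lra.

Import Order.TTheory GRing.Theory Num.Theory.
Import numFieldNormedType.Exports.

Local Open Scope ring_scope.
Local Open Scope classical_set_scope.

(** Put G = grad Phi. The Riemannian length of a straight segment [x, y] is at
    most sqrt <y - x, G y - G x>, by Cauchy-Schwarz applied to the integral of
    <D^2 Phi (y - x), y - x>. If w lies in Omega and u >= 1, the homothetic copy
    of Omega of ratio 1/u centred at w has uniform measure u^-d and lies within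
    D/u of w, whereas the complement of the ball of radius 2 sqrt (d u) has
    smaller Gaussian measure; hence some z with |z| <= 2 sqrt (d u) satisfies
    |G z - w| <= D/u. Taking u = 16^k and w close to G x yields points z_k such
    that the segment [z_{k+1}, z_k] has length O(sqrt (D sqrt d) / 2^k); a
    polygon through z_K, ..., z_0 therefore joins x to the ball of radius
    2 sqrt d within length O(d^(1/4) sqrt D), and two points of that ball whose
    gradients are near Omega are joined by a segment of the same order. *)

(** * Lebesgue measure on rows under homotheties *)

Section affine_change_of_variables.
Context {R : realType}.
Local Open Scope ereal_scope.

Lemma rV_cons_ord0 n (t : R) (v : 'rV[R]_n) : rV_cons (t, v) ord0 ord0 = t.
Proof. by have [] := rV_consK (t, v). Qed.

Lemma rV_cons_lift n (t : R) (v : 'rV[R]_n) j :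
  rV_cons (t, v) ord0 (lift ord0 j) = v ord0 j.
Proof.
have -> : lift ord0 j = rshift 1 j by apply: val_inj.
by rewrite /rV_cons (@row_mxEr _ 1 1 n).
Qed.

Lemma row_affineE n (a v : 'rV[R]_n) (s : R) i :
  ((a + s *: v) ord0 i = a ord0 i + s * v ord0 i)%R.
Proof. by rewrite !mxE. Qed.

Lemma measurable_affine (a s : R) :
  measurable_fun setT ((fun x => a + s * x)%R : _ -> measurableTypeR R).
Proof. by apply: measurable_funD => //; apply: measurable_funM. Qed.

(** The pushforward of Lebesgue measure under [h], multiplied by [s], agrees with Lebesgue measure
    on half-open intervals, hence on all measurable sets by uniqueness. *)
Lemma ge0_integral_affine (a s : R) (f : measurableTypeR R -> \bar R) :
  (0 < s)%R -> measurable_fun setT f -> (forall x, 0 <= f x) ->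
  \int[lebesgue_measure]_x f (a + s * x)%R =
  (s^-1)%:E * \int[lebesgue_measure]_x f x.
Proof.
move=> s0 mf f0.
pose h : measurableTypeR R -> measurableTypeR R := fun x => (a + s * x)%R.
have mh : measurable_fun setT h := measurable_affine a s.
have [p pA pf] : exists2 p : {measure set (measurableTypeR R) -> \bar R},
    (forall A, p A = lebesgue_measure (h @^-1` A)) &
    \int[p]_x f x = \int[lebesgue_measure]_x f (h x).
  unshelve eexists (pushforward lebesgue_measure h) => //.
  by rewrite ge0_integral_pushforward.
pose m := mscale (NngNum (ltW s0)) p.
have mE A : measurable A -> lebesgue_measure A = m A.
  apply: lebesgue_measure_unique => _ [[u v]] _ <-.
  rewrite /m /= /mscale pA.
  have -> : h @^-1` `]u, v]%classic = `]((u - a) / s)%R, ((v - a) / s)%R]%classic.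
    apply/seteqP; split => x /=; rewrite !in_itv /= /h;
      by rewrite ltr_pdivrMr// ler_pdivlMr// ltrBlDl lerBrDl (mulrC x s).
  rewrite !lebesgue_measure_itv /= !lte_fin ltr_pM2r ?invr_gt0// ltrD2r.
  case: ifPn => _; last by rewrite mule0.
  by rewrite -!EFinB -EFinM; congr EFin; field; rewrite gt_eqF.
rewrite [in RHS](eq_measure_integral m); last first.
  by move=> A mA _; exact: mE.
by rewrite ge0_integral_mscale//= muleA -EFinM mulVf ?gt_eqF// mul1e pf.
Qed.

Lemma ge0_integral_rV_cons n (f : 'rV[measurableTypeR R]_n.+1 -> \bar R) :
  measurable_fun setT f -> (forall x, 0 <= f x) ->
  \int[lebesgue_row n.+1]_x f x =
  \int[lebesgue_measure]_a \int[lebesgue_row n]_v f (rV_cons (a, v)).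
Proof.
move=> mf f0.
have -> : \int[lebesgue_row n.+1]_x f x =
    \int[pushforward (lebesgue_measure \x lebesgue_row n) (@rV_cons R n)]_x f x.
  by [].
rewrite (ge0_integral_pushforward (@measurable_rV_cons R n))//.
rewrite preimage_setT fubini_tonelli1//; last by move=> x; exact: f0.
by apply: measurableT_comp => //; exact: measurable_rV_cons.
Qed.

Lemma measurable_row_affine n (a : 'rV[R]_n) (s : R) :
  measurable_fun setT
    ((fun v => a + s *: v)%R : 'rV[measurableTypeR R]_n -> 'rV[measurableTypeR R]_n).
Proof.
apply: measurable_fun_row => i.
have -> : (fun v : 'rV[R]_n => (a + s *: v)%R ord0 i) =
    (fun t => a ord0 i + s * t)%R \o (fun v : 'rV[R]_n => v ord0 i).
  by apply/funext => v /=; rewrite !mxE.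
apply: measurableT_comp; first exact: (measurable_affine (a ord0 i) s).
exact: measurable_coord.
Qed.

(** Induction on [n]: Tonelli isolates the first coordinate, and each coordinate contributes one
    factor [s^-1]. *)
Lemma ge0_integral_row_affine n (a : 'rV[R]_n) (s : R)
    (f : 'rV[measurableTypeR R]_n -> \bar R) :
  (0 < s)%R -> measurable_fun setT f -> (forall x, 0 <= f x) ->
  \int[lebesgue_row n]_x f (a + s *: x)%R =
  (s ^- n)%:E * \int[lebesgue_row n]_x f x.
Proof.
move=> s0; elim: n a f => [|n IH] a f mf f0.
  rewrite expr0 invr1 mul1e; apply: eq_integral => x _.
  by congr f; apply/rowP => -[].
have sV0 : 0 <= (s ^- n)%:E by rewrite lee_fin invr_ge0 exprn_ge0 ?ltW.
rewrite ge0_integral_rV_cons//; last first.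
  by apply: measurableT_comp => //; exact: measurable_row_affine.
have mfc : measurable_fun setT (f \o @rV_cons R n).
  by apply: measurableT_comp => //; exact: measurable_rV_cons.
have mfc1 (t : measurableTypeR R) :
    measurable_fun setT (fun v => f (rV_cons (t, v))).
  exact: (measurableT_comp mfc (measurable_pair1 t)).
pose a' : 'rV[R]_n := (\row_j a ord0 (lift ord0 j))%R.
pose F (t : measurableTypeR R) := \int[lebesgue_row n]_v f (rV_cons (t, v)).
have mF : measurable_fun setT F.
  apply: (@measurable_fun_fubini_tonelli_F _ _ (measurableTypeR R) _ R
    (lebesgue_row n) _ mfc) => x; exact: f0.
have F0 t : 0 <= F t by exact: integral_ge0.
transitivity (\int[lebesgue_measure]_(t in @setT (measurableTypeR R))
    ((s ^- n)%:E * F (a ord0 ord0 + s * t)%R)).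
  apply: eq_integral => t _; rewrite /F -(IH a')//; last exact: mfc1.
  apply: eq_integral => v _; congr f.
  apply/rowP => i; rewrite row_affineE; have [j ->|->] := unliftP ord0 i.
    by rewrite !rV_cons_lift row_affineE mxE.
  by rewrite !rV_cons_ord0.
rewrite ge0_integralZl//; last first.
  by apply: (measurableT_comp mF); exact: measurable_affine.
rewrite (ge0_integral_affine (a ord0 ord0) _ _ s0 mF F0) -ge0_integral_rV_cons//.
by rewrite muleA -EFinM exprS invfM mulrC.
Qed.

Lemma lebesgue_row_affine n (a : 'rV[R]_n) (s : R)
    (A : set 'rV[measurableTypeR R]_n) : (0 < s)%R -> measurable A ->
  lebesgue_row n ((fun v => a + s *: v)%R @^-1` A) =
  (s ^- n)%:E * lebesgue_row n A.
Proof.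
move=> s0 mA.
have mB : measurable ((fun v => a + s *: v)%R @^-1` A).
  by rewrite -[X in measurable X]setTI; exact: measurable_row_affine.
have indE (B : set 'rV[measurableTypeR R]_n) : measurable B ->
    lebesgue_row n B = \int[lebesgue_row n]_x (\1_B x)%:E.
  by move=> ?; rewrite integral_indic// setIT.
rewrite !indE// -(ge0_integral_row_affine _ a s (fun x => (\1_A x)%:E))//.
exact/measurable_EFinP.
Qed.

(* The image of [A] under the homothety is covered by the images of the pieces
   of any cover of [A], so no measurability of [A] is needed. *)
Lemma volume_affine n (a : 'rV[R]_n) (s : R) (A : set 'rV[R]_n) : (0 < s)%R ->
  (s ^+ n)%:E * volume A <= volume [set (a + s *: v)%R | v in A].
Proof.
move=> s0; rewrite /volume /mu_ext.
apply: le_ereal_inf_tmp => _ [F [mF AF] <-].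
pose B k : set 'rV[R]_n := (fun v => a + s *: v)%R @^-1` F k.
have mB k : measurable (B k).
  rewrite -[X in measurable X]setTI.
  by apply: measurable_row_affine => //; exact: mF.
rewrite -lee_pdivlMl ?exprn_gt0//.
apply: ereal_inf_lbound; exists B; first split => //.
  move=> v Av; have [|k _ Fk] := AF (a + s *: v)%R; first by exists v.
  by exists k.
rewrite -nneseriesZl; last by move=> *; exact: measure_ge0.
by apply: eq_eseriesr => k _; rewrite lebesgue_row_affine//; exact: mF.
Qed.

(** Tonelli, one coordinate at a time; applied below to a Gaussian factor and to the indicator of an
    interval. *)
Lemma ge0_integral_row_prod n (f : R -> R) (c : R) :
  measurable_fun setT f -> (forall x, 0 <= f x)%R ->
  \int[lebesgue_measure]_x (f x)%:E = c%:E ->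
  \int[lebesgue_row n]_x (\prod_(i < n) f (x ord0 i))%:E = (c ^+ n)%:E.
Proof.
move=> mf f0 fc; elim: n => [|n IH].
  under eq_integral do rewrite big_ord0.
  by rewrite expr0 integral_cst//= diracT mule1.
have mp k : measurable_fun setT
    (fun x : 'rV[measurableTypeR R]_k => (\prod_(i < k) f (x ord0 i))%:E).
  apply/measurable_EFinP; apply: measurable_prod => i _.
  by apply: measurableT_comp => //; exact: (@measurable_coord _ (measurableTypeR R)).
have p0 k (x : 'rV[R]_k) : 0 <= (\prod_(i < k) f (x ord0 i))%:E.
  by rewrite lee_fin prodr_ge0.
rewrite ge0_integral_rV_cons//.
transitivity (\int[lebesgue_measure]_t ((c ^+ n)%:E * (f t)%:E)).
  apply: eq_integral => t _.
  transitivity (\int[lebesgue_row n]_v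
      ((f t)%:E * (\prod_(i < n) f (v ord0 i))%:E)).
    apply: eq_integral => v _; rewrite big_ord_recl rV_cons_ord0.
    by under eq_bigr do rewrite rV_cons_lift.
  by rewrite ge0_integralZl ?lee_fin// ?IH 1?muleC//; exact: mp.
rewrite ge0_integralZl//.
- by rewrite fc -EFinM exprSr.
- exact/measurable_EFinP.
- by move=> x _; rewrite lee_fin.
- by rewrite lee_fin exprn_ge0// -lee_fin -fc integral_ge0// => x _; rewrite lee_fin.
Qed.

End affine_change_of_variables.

(** * Euclidean norm, closed balls and cubes *)

Section euclidean_norm.
Context {R : realType} {d : nat}.
Implicit Types x y z : 'rV[R]_d.

Definition dotp x y : R := \sum_(i < d) x ord0 i * y ord0 i.

Lemma enorm_ge0 x : 0 <= enorm x. Proof. exact: sqrtr_ge0. Qed.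

Lemma enormN x : enorm (- x) = enorm x.
Proof. by congr Num.sqrt; apply: eq_bigr => i _; rewrite mxE sqrrN. Qed.

Lemma enorm_distC x y : enorm (x - y) = enorm (y - x).
Proof. by rewrite -enormN opprB. Qed.

Lemma enormZ (a : R) x : 0 <= a -> enorm (a *: x) = a * enorm x.
Proof.
move=> a0; rewrite -[in RHS](ger0_norm a0) -sqrtr_sqr /enorm -sqrtrM ?sqr_ge0//.
by rewrite mulr_sumr; congr Num.sqrt; apply: eq_bigr => i _; rewrite mxE exprMn.
Qed.

(* Cauchy-Schwarz: [2 |x| |y| <x, y> <= 2 |x|^2 |y|^2] by AM-GM termwise. *)
Lemma dotp_le_enorm x y : dotp x y <= enorm x * enorm y.
Proof.
have zero_coord z i : enorm z = 0 -> z ord0 i = 0.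
  move=> /(congr1 (fun r => r ^+ 2)) /eqP; rewrite enorm_sqr expr0n/=.
  rewrite psumr_eq0; last by move=> *; exact: sqr_ge0.
  by move=> /allP /(_ i (mem_index_enum _)); rewrite sqrf_eq0 => /eqP.
have [x0|x0] := eqVneq (enorm x) 0.
  by rewrite x0 mul0r /dotp big1// => i _; rewrite (zero_coord x i x0) mul0r.
have [y0|y0] := eqVneq (enorm y) 0.
  by rewrite y0 mulr0 /dotp big1// => i _; rewrite (zero_coord y i y0) mulr0.
have xp : 0 < enorm x by rewrite lt_def x0 enorm_ge0.
have yp : 0 < enorm y by rewrite lt_def y0 enorm_ge0.
rewrite -(ler_pM2l (mulr_gt0 (ltr0Sn _ 1) (mulr_gt0 xp yp))).
apply: (@le_trans _ _ (\sum_(i < d) (enorm y ^+ 2 * x ord0 i ^+ 2 +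
    enorm x ^+ 2 * y ord0 i ^+ 2))).
  rewrite /dotp mulr_sumr; apply: ler_sum => i _.
  have := sqr_ge0 (enorm y * x ord0 i - enorm x * y ord0 i); lra.
by rewrite big_split/= -!mulr_sumr -!enorm_sqr; lra.
Qed.

Lemma enormD x y : enorm (x + y) <= enorm x + enorm y.
Proof.
rewrite -(@ler_pXn2r _ 2)// ?nnegrE ?addr_ge0 ?enorm_ge0//.
rewrite sqrrD !enorm_sqr.
have -> : \sum_(i < d) (x + y) ord0 i ^+ 2 =
    \sum_(i < d) x ord0 i ^+ 2 + dotp x y *+ 2 + \sum_(i < d) y ord0 i ^+ 2.
  rewrite /dotp -sumrMnl -!big_split/=; apply: eq_bigr => i _.
  by rewrite mxE sqrrD.
by rewrite lerD2r lerD2l lerMn2r /= dotp_le_enorm.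
Qed.

Lemma enorm_dist_trans y x z : enorm (x - z) <= enorm (x - y) + enorm (y - z).
Proof. by rewrite -(subrKA y) enormD. Qed.

Definition cball y (r : R) : set 'rV[R]_d := [set w | enorm (w - y) <= r].

(** Closed balls of the sup norm: they express neighbourhoods in the topology of ['rV[R]_d], whereas
    [cball] is Euclidean. *)
Definition cube x (r : R) : set 'rV[R]_d :=
  [set z | forall i, `|z ord0 i - x ord0 i| <= r].

Lemma measurable_cball y r : measurable (cball y r : set 'rV[measurableTypeR R]_d).
Proof.
have [r0|r0] := ltP r 0.
  rewrite (_ : cball y r = set0)// -subset0 => w /=.
  by move=> /(le_trans (enorm_ge0 _)); rewrite leNgt r0.
have -> : cball y r =
    (fun w : 'rV[R]_d => \sum_(i < d) (w ord0 i - y ord0 i) ^+ 2) @^-1` `]-oo, r ^+ 2].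
  apply/funext => w; rewrite /cball /= in_itv /=.
  rewrite -[X in is_true X](@ler_pXn2r _ 2)// ?nnegrE ?enorm_ge0// enorm_sqr.
  by congr (is_true (_ <= _)); apply: eq_bigr => i _; rewrite !mxE.
rewrite -[X in measurable X]setTI; apply: measurable_sum => // i.
apply: measurable_funX; apply: measurable_funB => //.
exact: (@measurable_coord _ (measurableTypeR R)).
Qed.

Lemma measurable_cube x r : measurable (cube x r : set 'rV[measurableTypeR R]_d).
Proof.
have -> : cube x r = \big[setI/setT]_(i < d)
    ((fun z : 'rV[R]_d => z ord0 i) @^-1` `[x ord0 i - r, x ord0 i + r]).
  rewrite -bigcap_seq; apply/seteqP; split => z /= H i.
    by move=> _ /=; rewrite in_itv /= -ler_distl.
  have := H i (mem_index_enum i); by rewrite /= in_itv /= -ler_distl.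
apply: bigsetI_measurable => i _.
rewrite -[X in measurable X]setTI.
by apply: (@measurable_coord _ (measurableTypeR R)).
Qed.

End euclidean_norm.

(** * Concentration and positivity of the Gaussian measure *)

Section gaussian_tail.
Context {R : realType}.

(** The integrand is a multiple of the centred normal density of variance 2. *)
Lemma integral_expR_sqr_quarter :
  (\int[lebesgue_measure]_x (expR (- (x ^+ 2 / 4)))%:E =
  (Num.sqrt (4 * pi))%:E :> \bar R)%E.
Proof.
have s0 : Num.sqrt 2 != 0%R :> R by rewrite gt_eqF// sqrtr_gt0.
have peakE : (normal_peak (Num.sqrt 2) = (Num.sqrt (4 * pi))^-1 :> R)%R.
  rewrite /normal_peak sqr_sqrtr//; congr (Num.sqrt _)^-1.
  by rewrite mulr2n; lra.
have pos : (0 < Num.sqrt (4 * pi) :> R)%R by rewrite sqrtr_gt0 mulr_gt0// pi_gt0.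
have funE x : expR (- (x ^+ 2 / 4)) =
    (Num.sqrt (4 * pi) * normal_pdf 0 (Num.sqrt 2) x)%R :> R.
  rewrite normal_pdfE// peakE /normal_fun mulrA mulfV ?gt_eqF// mul1r.
  by congr expR; rewrite subr0 sqr_sqrtr// mulNr; congr (- (_ / _))%R; lra.
under eq_integral do rewrite funE EFinM.
rewrite ge0_integralZl//.
- by rewrite integral_normal_pdf mule1.
- by apply/measurable_EFinP; exact: measurable_normal_pdf.
- by move=> x _; rewrite lee_fin normal_pdf_ge0.
Qed.

(** The integrand factorizes over the coordinates, so the value is the [d]-th power of the quotient
    of [Num.sqrt (4 * pi)] by [Num.sqrt (2 * pi)]. *)
Lemma gaussian_exp_moment d :
  (\int[lebesgue_row d]_x
    (gaussian_density x * expR (enorm x ^+ 2 / 4))%:E = (Num.sqrt 2 ^+ d)%:E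
  :> \bar R)%E.
Proof.
have tp : (0 < 2 * pi :> R)%R by rewrite mulr_gt0// pi_gt0.
pose K : R := (2 * pi) `^ (- (d%:R / 2)).
have KE : K = (Num.sqrt (2 * pi) ^- d)%R.
  rewrite /K powRN (mulrC d%:R) powRrM powR12_sqrt ?ltW//.
  by rewrite powR_mulrn// sqrtr_ge0.
transitivity (\int[lebesgue_row d]_x
    (K%:E * (\prod_(i < d) expR (- (x ord0 i ^+ 2 / 4)))%:E))%E.
  apply: eq_integral => x _; rewrite -EFinM /gaussian_density -mulrA -expRD.
  rewrite -expR_sum; congr (_ * expR _)%:E.
  rewrite sumrN -mulr_suml -enorm_sqr; lra.
have mf : measurable_fun setT (fun x : R => expR (- (x ^+ 2 / 4))).
  apply: measurableT_comp => //; apply: measurableT_comp => //.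
  by apply: measurable_funM => //; exact: measurable_funX.
rewrite ge0_integralZl//.
- rewrite (ge0_integral_row_prod _ _ _ mf _ integral_expR_sqr_quarter)//.
  rewrite -EFinM KE; congr EFin.
  rewrite (_ : 4 * pi = 2 * (2 * pi))%R; last by lra.
  by rewrite [Num.sqrt (2 * (2 * pi))]sqrtrM// exprMn mulrCA mulVf ?mulr1// expf_neq0// gt_eqF// sqrtr_gt0.
- apply/measurable_EFinP; apply: measurable_prod => i _.
  by apply: (measurableT_comp mf); exact: (@measurable_coord _ R).
- by move=> x _; rewrite lee_fin prodr_ge0// => i _; exact: expR_ge0.
- by rewrite lee_fin powR_ge0.
Qed.

(* Exponential Markov inequality, using [E exp(|x|^2/4) = 2^(d/2)]. *)
Lemma gaussian_tail d (u : R) (A : set 'rV[R]_d) : measurable A ->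
  (forall x, A x -> 4 * u <= enorm x ^+ 2)%R ->
  (gaussian_measure A <= (expR (- u) * Num.sqrt 2 ^+ d)%:E)%E.
Proof.
move=> mA Au.
have mg : measurable_fun setT (fun x : 'rV[R]_d =>
    (gaussian_density x * expR (enorm x ^+ 2 / 4))%:E).
  apply/measurable_EFinP; apply: measurable_funM.
    exact: measurable_gaussian_density.
  apply: measurableT_comp => //; apply: measurable_funM => //.
  exact: measurable_enorm_sqr.
have g0 (x : 'rV[R]_d) :
    (0 <= (gaussian_density x * expR (enorm x ^+ 2 / 4))%:E)%E.
  by rewrite lee_fin mulr_ge0 ?gaussian_density_ge0 ?expR_ge0.
apply: (@le_trans _ _ (\int[lebesgue_row d]_(x in A)
    ((expR (- u))%:E * (gaussian_density x * expR (enorm x ^+ 2 / 4))%:E))%E).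
  apply: ge0_le_integral => //.
  - by move=> x _; rewrite lee_fin gaussian_density_ge0.
  - by apply: measurable_funTS; apply/measurable_EFinP; exact: measurable_gaussian_density.
  - by apply: measurable_funTS; exact: measurable_funeM.
  - move=> x Ax; rewrite -EFinM lee_fin mulrCA ler_peMr ?gaussian_density_ge0//.
    rewrite -expRD (le_trans _ (expR_ge1Dx _))//; have := Au _ Ax; lra.
rewrite ge0_integralZl//.
- rewrite EFinM -gaussian_exp_moment lee_pmul2l// ?lte_fin ?expR_gt0//.
  exact: ge0_subset_integral.
- exact: measurable_funTS.
Qed.

(** The density has a positive lower bound on the cube, and the cube is a homothetic copy of
    [cube 0 1], whose Lebesgue measure is positive. *)
Lemma gaussian_measure_cube d (x : 'rV[R]_d) (r : R) : (0 < r)%R ->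
  (0 < gaussian_measure (cube x r))%E.
Proof.
move=> r0.
have mQ := measurable_cube x r.
have Q0 : (0 < lebesgue_row d (cube x r))%E.
  (* The indicator of [cube 0 1] is the product of [f] over the coordinates, which gives the volume
     [2 ^+ d]. *)
  pose f (t : R) : R := \1_`[(-1)%R, 1%R] t.
  have fi : (\int[lebesgue_measure]_t (f t)%:E = 2%:E)%E.
    rewrite integral_indic// setIT /= lebesgue_measure_itv/= lte_fin -EFinB.
    by case: ifPn => [_|/negP[]]; [congr EFin; lra|lra].
  have f_in t : `|t| <= 1 -> f t = 1.
    by move=> t1; rewrite /f indicE mem_set//= in_itv/= -ler_norml.
  have f_out t : ~ `|t| <= 1 -> f t = 0.
    by move=> t1; rewrite /f indicE memNset//= in_itv/= -ler_norml.
  have mC := @measurable_cube R d 0 1.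
  have CE : lebesgue_row d (cube 0 1) = (2 ^+ d)%:E :> \bar R.
    rewrite -(ge0_integral_row_prod d f 2)//; last exact: measurable_indic.
    rewrite -(setIT (cube _ _)) -integral_indic//; apply: eq_integral => z _.
    congr EFin; rewrite indicE; case: (asboolP (cube 0 1 z)) => Cz.
      rewrite mem_set// big1// => i _; rewrite f_in//.
      by have := Cz i; rewrite mxE subr0.
    rewrite memNset//.
    have [i zi] : exists i, ~ `|z ord0 i - (0 : 'rV[R]_d) ord0 i| <= 1.
      by apply/existsNP.
    rewrite (bigD1 i)//= f_out ?mul0r//.
    by move: zi; rewrite mxE subr0.

  have : (0 < lebesgue_row d (cube 0 1) :> \bar R)%E.
    by rewrite CE lte_fin exprn_gt0.
  have -> : cube (0 : 'rV[R]_d) 1 = (fun v => x + r *: v) @^-1` cube x r.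
    have E (v : 'rV[R]_d) i : (`|(x + r *: v) ord0 i - x ord0 i| <= r) =
        (`|v ord0 i - (0 : 'rV[R]_d) ord0 i| <= 1).
      rewrite row_affineE mxE subr0 addrAC subrr add0r normrM (gtr0_norm r0).
      by rewrite -ler_pdivlMl// mulVf// gt_eqF.
    by apply/seteqP; split => v Cv i; have := Cv i; rewrite /= E.
  rewrite lebesgue_row_affine// => Q0; rewrite lt0e measure_ge0 andbT.
  by apply: contraTneq Q0 => ->; rewrite mule0 ltxx.
(* [M] bounds [enorm z ^+ 2] on the cube, so [m] bounds the density from below there. *)
pose M : R := \sum_(i < d) (`|x ord0 i| + r) ^+ 2.
pose m : R := (2 * pi) `^ (- (d%:R / 2)) * expR (- (M / 2)).
have m0 : 0 < m by rewrite mulr_gt0 ?expR_gt0// powR_gt0// mulr_gt0// pi_gt0.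
suff : (m%:E * lebesgue_row d (cube x r) <= gaussian_measure (cube x r))%E.
  by apply: lt_le_trans; rewrite mule_gt0.
rewrite -integral_cst//; apply: ge0_le_integral => //.
- by move=> z _; rewrite lee_fin ltW.
- by apply: measurable_funTS; apply/measurable_EFinP; exact: measurable_gaussian_density.
- move=> z Qz; rewrite lee_fin ler_wpM2l ?powR_ge0// ler_expR lerN2.
  rewrite ler_pM2r ?invr_gt0// enorm_sqr; apply: ler_sum => i _.
  rewrite -real_normK ?num_real// ler_pXn2r ?nnegrE ?addr_ge0 ?(ltW r0)//.
  by rewrite -[z ord0 i](subrK (x ord0 i)) addrC (le_trans (ler_normD _ _))// lerD2l Qz.
Qed.

End gaussian_tail.

(** * Consequences of pushing the Gaussian measure onto a convex set *)

Section transport_from_gaussian.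
Context {R : realType} {d : nat}.
Variables (Omega : set 'rV[R]_d) (G : 'rV[R]_d -> 'rV[R]_d).
Hypothesis volume_gt0 : (0 < volume Omega)%E.
Hypothesis transportG :
  transport_map gaussian_measure (uniform_measure Omega) G.

Let measurable_preimage (A : set 'rV[R]_d) :
  measurable A -> measurable (G @^-1` A).
Proof.
by move=> mA; rewrite -[X in measurable X]setTI; exact: transportG.1.
Qed.

(** Division by an infinite volume gives 0, so [uniform_measure Omega] would vanish, whereas a cube
    has positive Gaussian measure. *)
Lemma volume_fin_num : volume Omega \is a fin_num.
Proof.
rewrite ge0_fin_numE ?ltW// ltey; apply/eqP => vE.
have := transportG.2 setT measurableT.
rewrite preimage_setT /uniform_measure vE invey mule0 => g0.
have := @gaussian_measure_cube R d 0 1 ltr01.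
suff -> : gaussian_measure (@cube R d 0 1) = 0%E by rewrite ltxx.
apply/eqP; rewrite eq_le measure_ge0 andbT -g0.
by apply: le_measure; rewrite ?inE//; exact: measurable_cube.
Qed.

(** The preimage of the ball contains a cube, hence has positive Gaussian measure; the ball then has
    positive uniform measure and must meet [Omega]. *)
Lemma transport_image_adherent x (e r : R) : 0 < r ->
  cube x r `<=` G @^-1` cball (G x) e ->
  exists2 w, Omega w & enorm (w - G x) <= e.
Proof.
move=> r0 sub; have mB := measurable_cball (G x) e.
have : (0 < uniform_measure Omega (cball (G x) e))%E.
  rewrite -transportG.2//; apply: lt_le_trans (gaussian_measure_cube _ x _ r0) _.
  apply: le_measure => //; rewrite inE; first exact: measurable_cube.
  exact: measurable_preimage.
have [E|/set0P[w [Bw Ow]] _] := eqVneq (cball (G x) e `&` Omega) set0.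
  by rewrite /uniform_measure E /volume mu_ext0// mul0e ltxx.
by exists w.
Qed.

Hypothesis convex_Omega : convex_set Omega.
Variable D : R.
Hypothesis diam_Omega : forall w w', Omega w -> Omega w' -> enorm (w - w') <= D.

(* The homothetic copy [(1 - u^-1) w + u^-1 Omega] of Omega lies in the ball. *)
Lemma uniform_measure_cball w (u : R) : Omega w -> 1 <= u ->
  ((u ^- d)%:E <= uniform_measure Omega (cball w (D / u)))%E.
Proof.
move=> Ow u1; have u0 : 0 < u by apply: lt_le_trans u1.
have := volume_fin_num; have := volume_gt0.
have sub : [set (1 - u^-1) *: w + u^-1 *: v | v in Omega] `<=`
    cball w (D / u) `&` Omega.
  move=> _ [v Ov <-]; split.
    rewrite /cball /= (_ : _ - w = u^-1 *: (v - w)); last first.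
      by rewrite scalerBr scalerBl scale1r [LHS]addrC !addrA addNr sub0r addrC.
    rewrite enormZ ?invr_ge0 ?(ltW u0)// mulrC ler_pM2r ?invr_gt0//.
    exact: diam_Omega.
  have ui : u^-1 <= 1 by rewrite invf_le1.
  have u0' : 0 <= u^-1 by rewrite invr_ge0 ltW.
  have := @convex_Omega v w (Itv01 u0' ui).
  by rewrite !inE => /(_ Ov Ow); rewrite /conv /= addrC.
have ui0 : 0 < u^-1 by rewrite invr_gt0.
have := le_trans (volume_affine _ ((1 - u^-1) *: w) _ Omega ui0)
  (le_mu_ext _ sub).
rewrite /uniform_measure -/(volume _).
case: (volume Omega) => // v.
rewrite lte_fin => H v0 _; rewrite inver gt_eqF// lee_pdivlMr//.
by rewrite -exprVn.
Qed.

(* The preimage of the ball has Gaussian measure at least [u ^- d], which is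
   more than what the complement of the ball of squared radius [4 d u] has. *)
Lemma exists_controlled_preimage w (u : R) : (0 < d)%N -> Omega w -> 1 <= u ->
  exists2 z, enorm z ^+ 2 <= 4 * (d%:R * u) & enorm (G z - w) <= D / u.
Proof.
move=> d0 Ow u1; have u0 : 0 < u by apply: lt_le_trans u1.
apply: contrapT => noz.
have mB := measurable_cball w (D / u).
have := uniform_measure_cball w u Ow u1.
rewrite -transportG.2// leNgt => /negP; apply.
apply: le_lt_trans (gaussian_tail _ (d%:R * u) _ _ _) _.
- exact: measurable_preimage.
- move=> z Gz; rewrite leNgt; apply/negP => /ltW zu.
  by apply: noz; exists z.
have -> : expR (- (d%:R * u)) = expR (- u) ^+ d.
  by rewrite -expRM_natl mulrN.
(* Taking [d]-th roots, licit as [0 < d], leaves [expR (- u) * Num.sqrt 2 < u^-1]. *)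
rewrite lte_fin -exprMn -exprVn ltr_pXn2r// ?nnegrE ?mulr_ge0 ?expR_ge0 ?invr_ge0 ?(ltW u0)//.
have sqrt2_lt : Num.sqrt 2 < 2 :> R.
  by rewrite -(@ltr_pXn2r _ 2)// ?nnegrE ?sqrtr_ge0// sqr_sqrtr//; lra.
(* Square [1 + u / 2 <= expR (u / 2)] and apply AM-GM. *)
have exp_ge : 2 * u <= expR u.
  have -> : expR u = expR (u / 2) ^+ 2 by rewrite -expRM_natl; congr expR; lra.
  apply: (@le_trans _ _ ((1 + u / 2) ^+ 2)); first by have := sqr_ge0 (1 - u / 2); lra.
  by rewrite ler_pXn2r ?nnegrE ?expR_ge0 ?expR_ge1Dx// addr_ge0// divr_ge0// ltW.
rewrite expRN mulrC -ltr_pdivlMr ?invr_gt0 ?expR_gt0// invrK.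
rewrite -ltr_pdivrMl ?invr_gt0// invrK (lt_le_trans _ exp_ge)//.
by rewrite mulrC ltr_pM2r.
Qed.

End transport_from_gaussian.

(** * Differentiation along lines of functions with continuous partial derivatives *)

Section chain_rule_along_lines.
Context {R : realType} {d : nat}.

(** The two difference quotients are the same function of [h]. *)
Lemma is_derive_along (V : normedModType R) (f : V -> R) (y e : V) (s : R) :
  derivable f (y + s *: e) e ->
  is_derive s 1 (fun t : R => f (y + t *: e)) ('D_e f (y + s *: e)).
Proof.
have E : (fun h : R => h^-1 *: (((fun t : R => f (y + t *: e)) \o shift s)
      (h *: (1 : R)) - f (y + s *: e))) =
    (fun h => h^-1 *: ((f \o shift (y + s *: e)) (h *: e) - f (y + s *: e))).
  apply/funext => h /=; congr (_ *: (f _ - _)).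
  by rewrite /shift /= [h *: 1]mulr1 scalerDl addrCA.
by move=> fe; split; rewrite /derivable /derive E.
Qed.

Variable f : 'rV[R]_d -> R.
Hypothesis derivable_f : forall i x, derivable f x (delta_mx ord0 i).
Hypothesis continuous_partial_f : forall i, continuous (partial i f).

Lemma continuous_row_cube (F : 'rV[R]_d -> R) x (e : R) : continuous F -> 0 < e ->
  exists2 r, 0 < r & forall z, cube x r z -> `|F z - F x| <= e.
Proof.
move=> cF e0; have /cvgrPdist_le/(_ _ e0)/nbhs_ballP[r /= r0 Hr] := cF x.
exists (r / 2); first by rewrite divr_gt0.
move=> z xz; rewrite distrC; apply: Hr; split => // i j; rewrite (ord1 i).
by rewrite /ball /= distrC (le_lt_trans (xz j))//; lra.
Qed.

Let e_ i : 'rV[R]_d := delta_mx ord0 i.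

Lemma MVT_axis i (y : 'rV[R]_d) (a : R) : exists2 b : R, `|b| <= `|a| &
  f (y + a *: e_ i) - f y = a * partial i f (y + b *: e_ i).
Proof.
have pos (z : 'rV[R]_d) (c : R) : 0 <= c -> exists2 b : R, 0 <= b <= c &
    f (z + c *: e_ i) - f z = c * partial i f (z + b *: e_ i).
  move=> c0; pose g (t : R) := f (z + t *: e_ i).
  have dg (t : R) : is_derive t 1 g (partial i f (z + t *: e_ i)).
    exact: is_derive_along.
  have [|b bI] := @MVT_segment R g _ 0 c c0 (fun t _ => dg t).
    apply: continuous_subspaceT => t.
    by apply: differentiable_continuous; apply/derivable1_diffP; have [] := dg t.
  rewrite /g scale0r addr0 subr0 => E; exists b; last by rewrite E mulrC.
  by move: bI; rewrite in_itv.
have [a0|a0] := leP 0 a.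
  have [b /andP[b0 ba] E] := pos y a a0.
  by exists b => //; rewrite !ger0_norm.
(* For negative [a] the interval is traversed from its other end. *)
have [|b /andP[b0 ba] E] := pos (y + a *: e_ i) (- a); first by rewrite oppr_ge0 ltW.
exists (a + b); first by rewrite (ltr0_norm a0) ler0_norm; lra.
move: E; rewrite -!addrA -!scalerDl subrr scale0r addr0 mulNr => E.
by rewrite -opprB E opprK.
Qed.

(* Telescoping over the coordinates: [y k] is x with the first k coordinates
   of h added. *)
Lemma increment_linear_approx x (e : R) : 0 < e -> exists2 r, 0 < r &
  forall h : 'rV[R]_d, (forall i, `|h ord0 i| <= r) ->
  `|f (x + h) - f x - \sum_i h ord0 i * partial i f x| <=
    e * \sum_i `|h ord0 i|.
Proof.
move=> e0.
have /all_sig2[r r0 Hr] : forall i, {r | 0 < r &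
    forall z, cube x r z -> `|partial i f z - partial i f x| <= e}.
  by move=> i; apply/cid2/continuous_row_cube.
(* The default value 1 keeps [r'] positive in dimension 0. *)
pose r' := \big[Num.min/1]_i r i.
exists r'; first by apply: lt_bigmin => //.
move=> h hr.
pose y k := x + \row_i (if (i < k)%N then h ord0 i else 0).
have yS (i : 'I_d) : y i.+1 = y i + h ord0 i *: e_ i.
  apply/rowP => j; rewrite !mxE -addrA; congr (_ + _).
  rewrite eqxx /= ltnS leq_eqVlt (_ : (j == i :> nat) = (j == i))//.
  have [->|ji] := eqVneq j i; first by rewrite ltnn mulr1 add0r.
  by rewrite mulr0 addr0.
have -> : f (x + h) - f x = \sum_(i < d) (f (y i.+1) - f (y i)).
  rewrite -(big_mkord xpredT (fun i => f (y i.+1) - f (y i))).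
  rewrite telescope_sumr//; congr (f _ - f _); apply/rowP => j; rewrite !mxE.
    by rewrite ltn_ord.
  by rewrite addr0.
rewrite -sumrB mulr_sumr; apply: le_trans (ler_norm_sum _ _ _) _.
apply: ler_sum => i _; rewrite yS.
have [b bh ->] := MVT_axis i (y i) (h ord0 i).
rewrite -mulrBr normrM mulrC ler_wpM2r//; apply: Hr => j.
rewrite !mxE eqxx /=.
have hj : `|h ord0 j| <= r i.
  by apply: le_trans (hr j) _; exact: bigmin_le_cond.
have hi : `|h ord0 i| <= r i.
  by apply: le_trans (hr i) _; exact: bigmin_le_cond.
have [->|ji] := eqVneq j i.
  by rewrite ltnn addr0 mulr1 addrAC subrr add0r (le_trans bh).
rewrite mulr0 addr0 addrAC subrr add0r; case: ifP => // _.
by rewrite normr0 ltW.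
Qed.

(** The linear approximation is applied to the increment [h *: v], whose error is then divided by
    [h]. *)
Lemma is_derive_line (p v : 'rV[R]_d) (t : R) :
  is_derive t 1 (fun s : R => f (p + s *: v))
    (\sum_i v ord0 i * partial i f (p + t *: v)).
Proof.
pose x := p + t *: v.
pose N := \sum_i `|v ord0 i|.
suff lim : (fun h : R => h^-1 *: (((fun s : R => f (p + s *: v)) \o shift t)
    (h *: (1 : R)) - f x)) @ 0^' --> \sum_i v ord0 i * partial i f x.
  split; first by apply/cvg_ex; eexists; exact: lim.
  exact/cvg_lim.
have N0 : 0 <= N by apply: sumr_ge0.
apply/cvgrPdist_le => e e0.
(* The denominator is [N + 1] because [N] vanishes with [v]. *)
have e1 : 0 < e / (N + 1) by rewrite divr_gt0// ltr_wpDl.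
have [r r0 Hr] := increment_linear_approx x _ e1.
have r1 : 0 < r / (N + 1) by rewrite divr_gt0// ltr_wpDl.
near=> h.
have h0 : h != 0 by near: h; exact: nbhs_dnbhs_neq.
have hr : `|h| <= r / (N + 1).
  by near: h; exact: dnbhs0_le.
rewrite /= /shift /= [h *: 1]mulr1 scalerDl addrCA addrC -/x.
have hv i : (h *: v) ord0 i = h * v ord0 i by rewrite mxE.
have /Hr : forall i, `|(h *: v) ord0 i| <= r.
  move=> i; rewrite hv normrM -[leRHS](@divfK _ (N + 1)) ?gt_eqF ?ltr_wpDl//.
  apply: ler_pM => //; rewrite /N (bigD1 i)//= -addrA lerDl.
  by rewrite addr_ge0// sumr_ge0.
have -> : \sum_i (h *: v) ord0 i * partial i f x =
    h * \sum_i v ord0 i * partial i f x.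
  by rewrite mulr_sumr; apply: eq_bigr => i _; rewrite hv mulrA.
have -> : \sum_i `|(h *: v) ord0 i| = `|h| * N.
  by rewrite mulr_sumr; apply: eq_bigr => i _; rewrite hv normrM.
rewrite (addrC x) => E.
rewrite -(ler_pM2l (_ : 0 < `|h|)) ?normr_gt0// -normrM mulrBr.
rewrite [h * (_ *: _)]mulrA mulfV// mul1r distrC (le_trans E)//.
rewrite mulrCA ler_pM2l ?normr_gt0// mulrAC ler_pdivrMr ?ltr_wpDl//.
by rewrite ler_pM2l// lerDl.
Unshelve. all: by end_near.
Qed.

End chain_rule_along_lines.

(** * Riemannian length of a straight segment for the Hessian metric *)

Section segment_length.
Context {R : realType} {d : nat}.
Variable Phi : 'rV[R]_d -> R.
Hypothesis smooth_Phi : smooth Phi.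
Hypothesis posdef_Phi : forall x, posdef (hessian Phi x).

Lemma continuous_gradient_coord j : continuous (fun x => gradient Phi x ord0 j).
Proof.
have -> : (fun x => gradient Phi x ord0 j) = partial j Phi.
  by apply/funext => x; rewrite mxE.
exact: (smooth_Phi [:: j]).1.
Qed.

Lemma gradient_cube x (e : R) : 0 < e -> exists2 r, 0 < r &
  cube x r `<=` gradient Phi @^-1` cball (gradient Phi x) e.
Proof.
move=> e0.
(* The [d] squares of [e / d.+1] add up to at most [e ^+ 2]; the successor avoids dividing by 0. *)
have e1 : 0 < e / (d.+1)%:R by rewrite divr_gt0.
have /all_sig2[r r0 Hr] : forall i : 'I_d, {r | 0 < r & forall z, cube x r z ->
    `|gradient Phi z ord0 i - gradient Phi x ord0 i| <= e / (d.+1)%:R}.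
  move=> i; apply/cid2.
  exact: (continuous_row_cube _ _ _ (continuous_gradient_coord i)).
exists (\big[Num.min/1]_i r i); first exact: lt_bigmin.
move=> z xz; rewrite /cball /= -(@ler_pXn2r _ 2)// ?nnegrE ?enorm_ge0 ?(ltW e0)//.
rewrite enorm_sqr.
apply: (@le_trans _ _ (\sum_(i < d) (e / (d.+1)%:R) ^+ 2)).
  apply: ler_sum => i _; rewrite mxE [X in _ + X]mxE -real_normK ?num_real//.
  rewrite ler_pXn2r ?nnegrE ?(ltW e1)//; apply: Hr => j.
  by apply: le_trans (xz j) _; exact: bigmin_le_cond.
rewrite sumr_const card_ord -[leLHS]mulr_natl expr_div_n mulrCA ler_piMr ?sqr_ge0//.
rewrite ler_pdivrMr ?exprn_gt0// mul1r expr2 -natrM ler_nat.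
by rewrite (leq_trans (leqnSn d))// leq_pmulr.
Qed.

Lemma quadE (A : 'M[R]_d) (v : 'rV[R]_d) :
  quad A v = \sum_j v ord0 j * \sum_i v ord0 i * A i j.
Proof. by rewrite /quad mxE; apply: eq_bigr => j _; rewrite !mxE mulrC. Qed.

Lemma quad_hessian_ge0 x v : 0 <= quad (hessian Phi x) v.
Proof.
have [->|v0] := eqVneq v 0; last exact/ltW/posdef_Phi.
by rewrite quadE big1// => j _; rewrite mxE mul0r.
Qed.

(** The squared Riemannian speed of a line is thus an exact derivative, and its integral is an
    increment of the gradient. *)
Lemma is_derive_dotp_gradient (p v : 'rV[R]_d) (t : R) :
  is_derive t 1 (fun s : R => dotp v (gradient Phi (p + s *: v)))
    (quad (hessian Phi (p + t *: v)) v).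
Proof.
have -> : (fun s : R => dotp v (gradient Phi (p + s *: v))) =
    \sum_j (fun s : R => v ord0 j * partial j Phi (p + s *: v)).
  apply/funext => s; rewrite fct_sumE; apply: eq_bigr => j _.
  by rewrite mxE.
rewrite quadE; apply: is_derive_sum => j.
have D := is_derive_line _ (fun i x => (smooth_Phi [:: j]).2 i x)
  (fun i => (smooth_Phi [:: i; j]).1) p v t.
have -> : \sum_i v ord0 i * hessian Phi (p + t *: v) i j =
    \sum_i v ord0 i * partial i (partial j Phi) (p + t *: v).
  by apply: eq_bigr => i _; rewrite mxE.
exact: is_deriveZ.
Qed.

Lemma continuous_line (f : 'rV[R]_d -> R) (p v : 'rV[R]_d) :
  continuous f -> continuous (fun t : R => f (p + t *: v)).
Proof.
move=> cf t; apply: (@continuous_comp _ _ _ (fun t : R => p + t *: v) f).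
  by apply: cvgD; [exact: cvg_cst|exact: scalel_continuous].
exact: cf.
Qed.

Lemma continuous_quad_hessian (p v : 'rV[R]_d) :
  continuous (fun t : R => quad (hessian Phi (p + t *: v)) v).
Proof.
have -> : (fun t : R => quad (hessian Phi (p + t *: v)) v) =
    (fun t : R => \sum_j v ord0 j * \sum_i v ord0 i *
      partial i (partial j Phi) (p + t *: v)).
  apply/funext => t; rewrite quadE; apply: eq_bigr => j _; congr (_ * _).
  by apply: eq_bigr => i _; rewrite mxE.
have cM (c : R) (h : R -> R) : continuous h -> continuous (fun t => c * h t).
  by move=> ch t; apply: cvgM; [exact: cvg_cst|exact: ch].
have cS (F : 'I_d -> R -> R) : (forall i, continuous (F i)) ->
    continuous (fun t => \sum_i F i t).
  move=> cF; rewrite (_ : (fun t => _) = \sum_i F i); last first.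
    by apply/funext => t; rewrite fct_sumE.
  apply: (big_ind (fun h : R -> R => continuous h)) => [t|g h cg ch t|i _]; [exact: cvg_cst| |exact: cF].
  by apply: cvgD; [exact: cg|exact: ch].
apply: (cS) => j; apply: (cM); apply: (cS) => i; apply: (cM).
exact: (continuous_line _ _ _ (smooth_Phi [:: i; j]).1).
Qed.

Lemma continuous_speed (p v : 'rV[R]_d) :
  continuous (fun t : R => Num.sqrt (quad (hessian Phi (p + t *: v)) v)).
Proof.
move=> t; apply: continuous_comp; first exact: continuous_quad_hessian.
exact: sqrt_continuous.
Qed.

(* Cauchy-Schwarz in the form [sqrt q <= (q / s + s) / 2], with [s] tending to
   its optimal value; the integral of [q] is the increment of the gradient. *)
Lemma segment_length_le (p v : 'rV[R]_d) (a b : R) : a < b ->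
  (\int[lebesgue_measure]_(t in `[a, b])
     (Num.sqrt (quad (hessian Phi (p + t *: v)) v))%:E <=
   (Num.sqrt ((b - a) * dotp v (gradient Phi (p + b *: v) -
                                gradient Phi (p + a *: v))))%:E)%E.
Proof.
move=> ab; set W := dotp _ _; set X := (b - a) * W.
apply/lee_addgt0Pr => e e0.
have ba : 0 < b - a by rewrite subr_gt0.
(* The optimal [s] is [Num.sqrt X / (b - a)]; adding [e] keeps it positive when [X <= 0] and costs
   at most [e] in the bound. *)
pose r := Num.sqrt X + e.
have r0 : 0 < r by rewrite ltr_wpDl ?sqrtr_ge0.
pose s := r / (b - a).
have s0 : 0 < s by rewrite divr_gt0.
pose q (t : R) := quad (hessian Phi (p + t *: v)) v.
pose g (t : R) := 2^-1 * (s^-1 * q t + s).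
pose P (t : R) :=
  2^-1 * (s^-1 * dotp v (gradient Phi (p + t *: v)) + s * t).
have q0 t : 0 <= q t by exact: quad_hessian_ge0.
have cg : continuous g.
  move=> t; apply: cvgM; first exact: cvg_cst.
  apply: cvgD; last exact: cvg_cst.
  by apply: cvgM; [exact: cvg_cst|exact: continuous_quad_hessian].
have dP (t : R) : is_derive t 1 P (g t).
  have -> : P = 2^-1 \*: (s^-1 \*: (fun t : R => dotp v (gradient Phi (p + t *: v)))
      + s \*: (@id R)) by [].
  have D := is_derive_dotp_gradient p v t.
  have D1 := @is_deriveZ _ _ _ _ s^-1 _ _ _ D.
  have D2 := @is_deriveZ _ _ _ _ s _ _ _ (@is_derive_id _ _ t (1 : R)).
  have := @is_deriveZ _ _ _ _ 2^-1 _ _ _ (is_deriveD D1 D2).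
  by rewrite /g /q [s *: 1]mulr1.
have intg : (\int[lebesgue_measure]_(t in `[a, b]) (g t)%:E = (P b)%:E - (P a)%:E)%E.
  apply: continuous_FTC2 => //.
  - exact: continuous_subspaceT.
  - have cP (t : R) : {for t, continuous P}.
      by apply: differentiable_continuous; apply/derivable1_diffP; have [] := dP t.
    split; first by move=> t _; have [] := dP t.
    + by apply: cvg_at_right_filter; exact: cP.
    + by apply: cvg_at_left_filter; exact: cP.
  - by move=> t _; rewrite derive1E; have [] := dP t.
apply: (@le_trans _ _ (\int[lebesgue_measure]_(t in `[a, b]) (g t)%:E)%E).
  apply: ge0_le_integral => //.
  - apply/measurable_EFinP; apply: measurable_funTS.
    apply: continuous_measurable_fun; exact: continuous_speed.
  - apply/measurable_EFinP; apply: measurable_funTS.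
    exact: continuous_measurable_fun.
  - move=> t _; rewrite lee_fin /g -/(q t).
    set y := Num.sqrt (q t); have -> : q t = y ^+ 2 by rewrite sqr_sqrtr.
    rewrite -(ler_pM2l (mulr_gt0 (ltr0Sn _ 1) s0)).
    have -> : 2 * s * (2^-1 * (s^-1 * y ^+ 2 + s)) = y ^+ 2 + s ^+ 2.
      by field; rewrite gt_eqF.
    by have := sqr_ge0 (y - s); lra.
rewrite intg -EFinB -EFinD lee_fin.
have -> : P b - P a = 2^-1 * (X / r + r).
  rewrite /P /X /W /s.
  have -> : dotp v (gradient Phi (p + b *: v) - gradient Phi (p + a *: v)) =
      dotp v (gradient Phi (p + b *: v)) - dotp v (gradient Phi (p + a *: v)).
    rewrite /dotp -sumrB; apply: eq_bigr => i _.
    by rewrite mxE [X in _ + X]mxE mulrBr.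
  by field; rewrite gt_eqF//= gt_eqF.
have Xr : X / r <= Num.sqrt X.
  rewrite ler_pdivrMr//; have [X0|X0] := leP 0 X.
    by rewrite -[leLHS]sqr_sqrtr// expr2 ler_wpM2l ?sqrtr_ge0// lerDl ltW.
  by rewrite (le_trans (ltW X0))// mulr_ge0 ?sqrtr_ge0 ?ltW.
by rewrite /r in Xr *; lra.
Qed.

End segment_length.

(** * Straight lines, polygons and their Riemannian length *)

Lemma is_derive_affine {R : realType} {d : nat} (p v : 'rV[R]_d) (t : R) :
  is_derive t 1 (fun s : R => p + s *: v) v.
Proof.
suff lim : (fun h : R => h^-1 *: (((fun s : R => p + s *: v) \o shift t)
    (h *: (1 : R)) - (p + t *: v))) @ 0^' --> v.
  split; first by apply/cvg_ex; eexists; exact: lim.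
  exact/cvg_lim.
apply: cvg_near_cst; near=> h.
have h0 : h != 0 by near: h; exact: nbhs_dnbhs_neq.
rewrite /= /shift /= [h *: 1]mulr1 scalerDl opprD addrACA subrr add0r.
by rewrite addrK scalerA mulVf// scale1r.
Unshelve. all: by end_near.
Qed.

Lemma smooth_curve_line {R : realType} {d : nat} (p v : 'rV[R]_d) :
  smooth_curve (fun t : R => p + t *: v).
Proof.
have E1 : (fun t : R => p + t *: v)^`() = cst v.
  by apply/funext => t; rewrite derive1E; have [] := is_derive_affine p v t.
have E2 n : (fun t : R => p + t *: v)^`(n.+2) = cst 0.
  elim: n => [|n IH]; first by rewrite /derive1n /= E1; apply/funext => t; rewrite derive1_cst.
  by rewrite derive1nS IH; apply/funext => t; rewrite derive1_cst.
case=> [|[|n]] t.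
- by have [] := is_derive_affine p v t.
- by rewrite derive1n1 E1; exact: derivable_cst.
- by rewrite E2; exact: derivable_cst.
Qed.

Section polygonal_path.
Context {R : realType} {d : nat}.
Variable Phi : 'rV[R]_d -> R.
Hypothesis smooth_Phi : smooth Phi.
Hypothesis posdef_Phi : forall x, posdef (hessian Phi x).

(** The bound of [segment_length_le] for the segment from [x] to [y] run in unit time. *)
Definition seg_bound (x y : 'rV[R]_d) : R :=
  Num.sqrt (dotp (y - x) (gradient Phi y - gradient Phi x)).

Section polygon.
Variables (pts : nat -> 'rV[R]_d) (n : nat).
Hypothesis n_gt0 : (0 < n)%N.

(** The position at time 0 of the line that has velocity [vel k] and reaches [pts k] at time
    [node k]. *)
Let base k := pts k - k%:R *: (pts k.+1 - pts k).
Let vel k := n%:R *: (pts k.+1 - pts k).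
Let aff k (t : R) := base k + t *: vel k.
Let node (k : nat) : R := k%:R / n%:R.

(* Constant speed on each piece; at a node [truncn] selects the piece on the
   right, which takes the same value there. *)
Definition polygon (t : R) := aff (Num.truncn (n%:R * t)) t.

Let n0 : 0 < n%:R :> R. Proof. by rewrite ltr0n. Qed.

Let node_lt k : node k < node k.+1.
Proof. by rewrite /node ltr_pM2r ?invr_gt0// ltr_nat. Qed.

Let node_ge0 k : 0 <= node k.
Proof. by rewrite /node divr_ge0. Qed.

Let aff_node k : aff k (node k) = pts k.
Proof.
by rewrite /aff /vel /node scalerA divfK ?gt_eqF// /base subrK.
Qed.

Let aff_nodeS k : aff k (node k.+1) = pts k.+1.
Proof.
rewrite /aff /vel /node scalerA divfK ?gt_eqF// /base -addrA -scaleNr -scalerDl.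
by rewrite -natr1 addrA addNr add0r scale1r addrC subrK.
Qed.

Lemma polygon_node k : polygon (node k) = pts k.
Proof. by rewrite /polygon mulrC divfK ?gt_eqF// natrK aff_node. Qed.

Lemma polygon_piece k t : node k <= t <= node k.+1 -> polygon t = aff k t.
Proof.
move=> /andP[kt]; rewrite le_eqVlt => /predU1P[->|tk].
  by rewrite polygon_node aff_nodeS.
rewrite /polygon (_ : Num.truncn _ = k)//; apply: truncn_def.
by rewrite mulrC -ler_pdivrMr// kt -ltr_pdivlMr.
Qed.

Lemma piecewise_smooth_polygon : piecewise_smooth_path polygon.
Proof.
pose s := [seq node k.+1 | k <- iota 0 n].
have ss : size s = n by rewrite size_map size_iota.
have nthS k : (k < n)%N -> nth 0 s k = node k.+1.
  by move=> kn; rewrite (nth_map 0%N) ?size_iota// nth_iota.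
have nth0 k : (k <= n)%N -> nth 0 (0 :: s) k = node k.
  by case: k => [|k] kn; [rewrite /node mul0r|exact: nthS].
exists s; split.
  split.
    apply/(pathP 0) => i; rewrite ss => iN.
    by rewrite nth0 ?(ltnW iN)// nthS.
  by rewrite (last_nth 0) ss nth0// /node divff// gt_eqF.
move=> k; rewrite ss => kn; exists (aff k); first exact: smooth_curve_line.
rewrite nth0 ?(ltnW kn)// nth0// => t; rewrite inE /= in_itv => tI.
exact: polygon_piece.
Qed.

Let speed t := Num.sqrt (quad (hessian Phi (polygon t)) (polygon^`()%classic t)).

(** Strictly between two nodes the polygon agrees with a line near [t]; at a node the derivative
    need not exist. *)
Let speed_piece k t : node k < t < node k.+1 ->
  speed t = Num.sqrt (quad (hessian Phi (base k + t *: vel k)) (vel k)).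
Proof.
move=> /andP[kt tk]; rewrite /speed (polygon_piece k) ?ltW ?kt//.
have -> : polygon^`()%classic t = vel k; last by [].
rewrite derive1E (near_eq_derive (g := aff k)).
  by have [] := is_derive_affine (base k) (vel k) t.
near=> u; apply: polygon_piece; apply/andP; split; apply: ltW.
  by near: u; exact: lt_nbhsr.
by near: u; exact: lt_nbhsl.
Unshelve. all: by end_near.
Qed.

(** Induction over the pieces; measurability is carried along because splitting the integral at a
    node requires it. *)
Let speed_integral k :
  measurable_fun `[0, node k] speed /\
  (\int[lebesgue_measure]_(t in `[0%R, node k]) (speed t)%:E <=
   (\sum_(j < k) seg_bound (pts j) (pts j.+1))%:E)%E.
Proof.
elim: k => [|k [mk IH]].
  rewrite /node mul0r big_ord0 set_itv1; split; first exact: measurable_fun_set1.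
  by rewrite integral_set1.
have mo : measurable_fun `]node k, node k.+1[ speed.
  apply: (@eq_measurable_fun _ _ _ _ _ (fun t : R =>
      Num.sqrt (quad (hessian Phi (base k + t *: vel k)) (vel k)))).
    by move=> t; rewrite inE /= in_itv/= => /speed_piece ->.
  apply: measurable_funTS; apply: continuous_measurable_fun.
  exact: continuous_speed.
have mc : measurable_fun `]node k, node k.+1] speed.
  exact/measurable_fun_itv_bndo_bndcP.
have U : `[0, node k.+1]%classic = `[0, node k] `|` `]node k, node k.+1].
  by rewrite -itv_bndbnd_setU// bnd_simp// ltW.
have mU : measurable_fun `[0, node k.+1] speed.
  by rewrite U; apply/measurable_funU.
split=> //.
rewrite U ge0_integral_setU//; last 3 first.
- by rewrite -U; exact/measurable_EFinP.
- by move=> t _; rewrite lee_fin sqrtr_ge0.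
- apply/disj_setPS => t /= [].
  by rewrite !in_itv /= => /andP[_ tk] /andP[/lt_le_trans/(_ tk)]; rewrite ltxx.
rewrite big_ord_recr/= EFinD; apply: leeD => //.
(* The endpoints are negligible: the speed is known on the open piece, while [segment_length_le]
   integrates over the closed one. *)
rewrite integral_itv_bndoo; last exact/measurable_EFinP.
have -> : (\int[lebesgue_measure]_(t in `]node k, node k.+1[) (speed t)%:E =
    \int[lebesgue_measure]_(t in `]node k, node k.+1[)
      (Num.sqrt (quad (hessian Phi (base k + t *: vel k)) (vel k)))%:E)%E.
  by apply: eq_integral => t; rewrite inE /= in_itv/= => /speed_piece ->.
have mg : measurable_fun setT (fun t : R =>
    Num.sqrt (quad (hessian Phi (base k + t *: vel k)) (vel k))).
  by apply: continuous_measurable_fun; exact: continuous_speed.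
rewrite -(integral_itv_bndoo true false); last first.
  by apply/measurable_EFinP; exact: measurable_funTS.
apply: le_trans (segment_length_le _ smooth_Phi posdef_Phi _ _ _ _ (node_lt k)) _.
rewrite -/(aff k (node k)) -/(aff k (node k.+1)) aff_node aff_nodeS lee_fin.
(* Both sides are equal: the duration [1 / n] cancels the factor [n] of the velocity. *)
rewrite le_eqVlt; apply/orP; left; apply/eqP; congr Num.sqrt.
rewrite /dotp mulr_sumr; apply: eq_bigr => i _.
rewrite [in LHS]mxE /node -natr1; field; exact: lt0r_neq0.
Qed.

Lemma path_length_polygon :
  (path_length (hessian Phi) polygon <=
   (\sum_(j < n) seg_bound (pts j) (pts j.+1))%:E)%E.
Proof.
by have [_] := speed_integral n; rewrite /node divff// gt_eqF.
Qed.

End polygon.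

Lemma riem_dist_polygon (pts : nat -> 'rV[R]_d) (n : nat) : (0 < n)%N ->
  (riem_dist (hessian Phi) (pts 0%N) (pts n) <=
   (\sum_(j < n) seg_bound (pts j) (pts j.+1))%:E)%E.
Proof.
move=> n0; apply: le_trans (path_length_polygon pts n n0).
apply: ereal_inf_lbound; exists (polygon pts n) => //.
have nR : n%:R != 0 :> R by rewrite pnatr_eq0 -lt0n.
split; first exact: piecewise_smooth_polygon.
  by have := polygon_node pts n n0 0; rewrite mul0r.
by have := polygon_node pts n n0 n; rewrite divff.
Qed.

End polygonal_path.

(** * Chains of points at geometric scales *)

Lemma sum_geometric_half {R : realFieldType} (n : nat) :
  \sum_(j < n) 2^-1 ^+ j = 2 - 2 * 2^-1 ^+ n :> R.
Proof.
elim: n => [|n IH]; first by rewrite big_ord0 expr0; lra.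
by rewrite big_ord_recr /= IH exprS; lra.
Qed.

Section multiscale_chain.
Context {R : realType} {d : nat}.
Variable Phi : 'rV[R]_d -> R.
Hypothesis smooth_Phi : smooth Phi.
Hypothesis posdef_Phi : forall x, posdef (hessian Phi x).

Let G := gradient Phi.

Lemma seg_boundC x y : seg_bound Phi x y = seg_bound Phi y x.
Proof.
congr Num.sqrt; apply: eq_bigr => i _.
by rewrite -(opprB x y) -(opprB (gradient Phi x)) mxE [X in _ * X]mxE mulrNN.
Qed.

Lemma seg_bound_le x y (a b r : R) : enorm (y - x) <= a -> enorm (G y - G x) <= b ->
  0 <= r -> a * b <= r ^+ 2 -> seg_bound Phi x y <= r.
Proof.
move=> xa Gb r0 abr; rewrite -[r]ger0_norm// -sqrtr_sqr ler_sqrt ?sqr_ge0//.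
apply: le_trans (dotp_le_enorm _ _) (le_trans _ abr).
by apply: ler_pM; rewrite ?enorm_ge0.
Qed.

(** The polygon follows [L] backwards from [L m] to [L 0], crosses to [L' 0] and follows [L']
    forwards. *)
Lemma riem_dist_chains (L L' : nat -> 'rV[R]_d) (m m' : nat) :
  (riem_dist (hessian Phi) (L m) (L' m') <=
   (\sum_(j < m) seg_bound Phi (L j) (L j.+1) + seg_bound Phi (L 0%N) (L' 0%N) +
    \sum_(j < m') seg_bound Phi (L' j) (L' j.+1))%:E)%E.
Proof.
have [pts [ptsL ptsR]] : exists pts : nat -> 'rV[R]_d,
    (forall i, (i <= m)%N -> pts i = L (m - i)%N) /\
    (forall i, pts (m.+1 + i)%N = L' i).
  exists (fun i => if (i <= m)%N then L (m - i)%N else L' (i - m.+1)%N).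
  by split=> [i ->//|i]; rewrite leqNgt addSn ltnS leq_addr /= subSS addKn.
have := riem_dist_polygon Phi smooth_Phi posdef_Phi pts (m.+1 + m') isT.
rewrite ptsL// subn0 ptsR big_split_ord big_ord_recr.
have -> : \sum_(i < m) seg_bound Phi (pts (lshift m' (widen_ord (leqnSn m) i)))
      (pts (lshift m' (widen_ord (leqnSn m) i)).+1) =
    \sum_(j < m) seg_bound Phi (L j) (L j.+1).
  rewrite [RHS](reindex_inj rev_ord_inj); apply: eq_bigr => i _.
  have im := ltn_ord i; rewrite [LHS]seg_boundC; congr (seg_bound _ _ _).
    by rewrite ptsL.
  by rewrite ptsL ?(ltnW im)//= -subSn// subSS.
have -> : \sum_(i < m') seg_bound Phi (pts (rshift m.+1 i)) (pts (rshift m.+1 i).+1) =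
    \sum_(j < m') seg_bound Phi (L' j) (L' j.+1).
  apply: eq_bigr => i _; congr (seg_bound _ _ _); first by rewrite -ptsR.
  by rewrite -ptsR addnS.
have -> : seg_bound Phi (pts (lshift m' (@ord_max m))) (pts (lshift m' (@ord_max m)).+1) =
    seg_bound Phi (L 0%N) (L' 0%N); last by [].
congr (seg_bound _ _ _); first by rewrite ptsL// subnn.
by rewrite -[RHS]ptsR addn0.
Qed.

Variables (Omega : set 'rV[R]_d) (D : R).
Hypothesis D_ge0 : 0 <= D.
(** [adherent] and [controlled] abstract what the transport provides, so that the chaining is free
    of measure theory. *)
Hypothesis adherent : forall x (e : R), 0 < e ->
  exists2 w, Omega w & enorm (w - G x) <= e.
Hypothesis controlled : forall w (u : R), Omega w -> 1 <= u ->
  exists2 z, enorm z ^+ 2 <= 4 * (d%:R * u) & enorm (G z - w) <= D / u.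
Hypothesis diam_Omega : forall w w', Omega w -> Omega w' -> enorm (w - w') <= D.

Let sd : R := Num.sqrt d%:R.
(** The target bound up to a constant: the fourth root of [d] times the square root of [D]. *)
Let S : R := Num.sqrt (D * sd).

Let sd_ge0 : 0 <= sd. Proof. exact: sqrtr_ge0. Qed.

Let S_ge0 : 0 <= S. Proof. exact: sqrtr_ge0. Qed.

Let S_sqr : S ^+ 2 = D * sd. Proof. by rewrite sqr_sqrtr// mulr_ge0. Qed.

(* Points at scale k have gradient within [D / 16 ^ k] of a common point of
   Omega and norm [O(sqrt d 4 ^ k)], so that the k-th segment has length
   [O(S / 2 ^ k)]. *)
Lemma exists_chain x (e : R) : 0 < e -> exists (L : nat -> 'rV[R]_d) (m : nat),
  [/\ L m = x, \sum_(j < m) seg_bound Phi (L j) (L j.+1) <= 8 * S + e,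
      enorm (L 0%N) <= 2 * sd & exists2 w, Omega w & enorm (G (L 0%N) - w) <= D].
Proof.
move=> e0.
(* Since [B <= (enorm x + 2 * sd + 1) * 4 ^+ K], the inequality [A <= 4 ^+ K] makes
   [B * (D / 16 ^+ K)] at most [e ^+ 2 / 2]. *)
pose A := 2 * (D * (enorm x + 2 * sd + 1)) / e ^+ 2.
have A0 : 0 <= A.
  by rewrite divr_ge0 ?sqr_ge0// !mulr_ge0// !addr_ge0 ?enorm_ge0// mulr_ge0.
have [K AK] : exists K : nat, A <= 4 ^+ K.
  exists (Num.bound A); apply: (le_trans (ltW (archi_boundP A0))).
  by rewrite -natrX ler_nat ltnW// ltn_expl.
(* [B] bounds the distance from [x] to [z K]; the last term makes it positive. The next choice of
   [w] contributes the other [e ^+ 2 / 2] to the last segment. *)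
pose B := enorm x + 2 * sd * 4 ^+ K + 1.
have B0 : 0 < B.
  by rewrite ltr_wpDl// addr_ge0 ?enorm_ge0// !mulr_ge0// exprn_ge0.
have [|w Ow wx] := adherent x (e ^+ 2 / 2 / B).
  by rewrite !divr_gt0 ?exprn_gt0.
have sqr4 k : 16 ^+ k = (4 ^+ k) ^+ 2 :> R.
  by rewrite -exprM mulnC exprM; congr (_ ^+ _); rewrite expr2; lra.
have u1 k : 1 <= 16 ^+ k :> R by rewrite exprn_ege1// ler1n.
have /choice[z Hz] : forall k, exists z,
    enorm z <= 2 * sd * 4 ^+ k /\ enorm (G z - w) <= D / 16 ^+ k.
  move=> k; have [z z1 z2] := controlled w _ Ow (u1 k).
  exists z; split=> //; rewrite -(@ler_pXn2r _ 2)// ?nnegrE ?enorm_ge0//; last first.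
    by rewrite !mulr_ge0// exprn_ge0.
  rewrite (le_trans z1)// !exprMn sqr_sqrtr// -sqr4.
  by rewrite mulrA (_ : 2 ^+ 2 = 4 :> R)//; rewrite expr2; lra.
(* The chain is [z 0], ..., [z K], [x], hence [K.+1] segments. *)
pose L j := if (j <= K)%N then z j else x.
exists L, K.+1; split.
- by rewrite /L ltnn.
- rewrite big_ord_recr /=; apply: lerD.
    apply: (@le_trans _ _ (\sum_(j < K) 4 * S * 2^-1 ^+ j)).
      apply: ler_sum => j _; rewrite /L (ltnW (ltn_ord j)) ltn_ord.
      have [zj Gj] := Hz j; have [zj1 Gj1] := Hz j.+1.
      (* The norms add up to [(2 + 8) * sd * 4 ^+ j], and [1 + 1 / 16 <= 3 / 2]. The product is
         [15 * D * sd / 4 ^+ j], below the square of [4 * S * 2^-1 ^+ j]. *)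
      apply: (seg_bound_le _ _ (10 * sd * 4 ^+ j) (3 / 2 * (D / 16 ^+ j))).
      + apply: le_trans (enormD _ _) _; rewrite enormN.
        by move: zj zj1; rewrite exprS; lra.
      + apply: le_trans (enorm_dist_trans w _ _) _.
        rewrite (enorm_distC w); apply: le_trans (lerD Gj1 Gj) _.
        rewrite exprS invfM.
        have : 0 <= D / 16 ^+ j by rewrite divr_ge0// exprn_ge0.
        by lra.
      + by rewrite !mulr_ge0// exprn_ge0.
      + have q0 : 0 < 4 ^+ j :> R by rewrite exprn_gt0.
        rewrite exprMn exprAC (_ : 2^-1 ^+ 2 = 4^-1 :> R); last by field.
        rewrite exprMn S_sqr sqr4 exprVn -subr_ge0.
        have -> : 4 ^+ 2 * (D * sd) * (4 ^+ j)^-1 -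
            10 * sd * 4 ^+ j * (3 / 2 * (D / (4 ^+ j) ^+ 2)) =
            D * sd / 4 ^+ j.
          by field; rewrite gt_eqF.
        by rewrite divr_ge0 ?mulr_ge0// ltW.
    rewrite -mulr_sumr.
    rewrite sum_geometric_half mulrBr; have : 0 <= 4 * S * (2 * 2^-1 ^+ K).
      by rewrite !mulr_ge0// exprn_ge0.
    lra.
  rewrite /L leqnn ltnn.
  have [zK GK] := Hz K.
  apply: (seg_bound_le _ _ B (e ^+ 2 / 2 / B + D / 16 ^+ K)).
  + apply: le_trans (enormD _ _) _; rewrite enormN /B; lra.
  + apply: le_trans (enorm_dist_trans w _ _) _.
    by rewrite (enorm_distC _ w) (enorm_distC w (G (z K))) lerD.
  + exact: ltW.
  + rewrite mulrDr mulrC divfK ?gt_eqF//.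
    suff : B * (D / 16 ^+ K) <= e ^+ 2 / 2 by lra.
    have q1 : 1 <= 4 ^+ K :> R by rewrite exprn_ege1// ler1n.
    have q0 : 0 < 4 ^+ K :> R by apply: lt_le_trans q1.
    apply: (@le_trans _ _ ((enorm x + 2 * sd + 1) * 4 ^+ K * (D / 16 ^+ K))).
      rewrite ler_wpM2r ?divr_ge0 ?exprn_ge0// /B.
      by have := ler_peMr (enorm_ge0 x) q1; lra.
    rewrite sqr4 (_ : _ * (D / _) = D * (enorm x + 2 * sd + 1) / 4 ^+ K); last first.
      by field; rewrite gt_eqF.
    rewrite ler_pdivrMr//; move: AK; rewrite /A ler_pdivrMr ?exprn_gt0//; lra.
- by have [+ _] := Hz 0%N; rewrite /L /= expr0 mulr1.
- by exists w => //; have [_] := Hz 0%N; rewrite /L /= expr0 divr1.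
Qed.

(** Each of the two chains costs [8 * S], and the segment joining their initial points [4 * S]. *)
Lemma riem_dist_le x y : (riem_dist (hessian Phi) x y <= (20 * S)%:E)%E.
Proof.
apply/lee_addgt0Pr => e e0.
have e20 : 0 < e / 2 by rewrite divr_gt0.
have [L [m [<- SL L0 [w Ow Gw]]]] := exists_chain x _ e20.
have [L' [m' [<- SL' L0' [w' Ow' Gw']]]] := exists_chain y _ e20.
apply: le_trans (riem_dist_chains L L' m m') _.
rewrite -EFinD lee_fin.
have : seg_bound Phi (L 0%N) (L' 0%N) <= 4 * S.
  (* Both points have norm at most [2 * sd], and their gradients are within [D] of points of [Omega]
     that are themselves within [D] of each other; [12 <= 4 ^+ 2]. *)
  apply: (seg_bound_le _ _ (4 * sd) (3 * D)).
  - by apply: le_trans (enormD _ _) _; rewrite enormN; lra.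
  - apply: le_trans (enorm_dist_trans w' _ _) _.
    have := enorm_dist_trans w w' (G (L 0%N)).
    have := diam_Omega _ _ Ow' Ow.
    by rewrite (enorm_distC w (G (L 0%N))); lra.
  - by rewrite mulr_ge0.
  - by rewrite exprMn S_sqr; have := mulr_ge0 D_ge0 sd_ge0; lra.
lra.
Qed.

End multiscale_chain.

Theorem theorem1p3 (R : realType) :
  exists C : R, 0 < C /\
  forall (d : nat) (Omega : set 'rV[R]_d) (D : R) (Phi : 'rV[R]_d -> R),
    convex_set Omega ->
    (0 < volume Omega)%E ->
    diameter euclid_dist Omega = D%:E ->
    smooth Phi ->
    convex_function setT Phi ->
    (forall x, posdef (hessian Phi x)) ->
    optimal_transport_map gaussian_measure (uniform_measure Omega)
      (gradient Phi) ->
    geodesically_convex (hessian Phi) ->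
    (riem_diam (hessian Phi) <= (C * d%:R `^ (4^-1) * Num.sqrt D)%:E)%E.
Proof.
exists 20; split=> // d Omega D Phi cvxO volO diamO smP _ posP [trP _] _.
have diamOE w w' : Omega w -> Omega w' -> enorm (w - w') <= D.
  move=> Ow Ow'; rewrite -lee_fin -diamO.
  by apply: ereal_sup_ubound; exists w => //; exists w'.
have D0 : 0 <= D.
  have [E|/set0P[w Ow]] := eqVneq Omega set0.
    by move: volO; rewrite E /volume mu_ext0// ltxx.
  exact: le_trans (enorm_ge0 (w - w)) (diamOE _ _ Ow Ow).
apply: ge_ereal_sup => _ [x _ [y _ <-]].
(* [exists_controlled_preimage] requires a positive dimension; in dimension 0 a single segment has
   bound 0 because [dotp] is an empty sum. *)
have [d0|d0] := posnP d.
  apply: le_trans (riem_dist_polygon Phi smP posP (fun k => if k is 0 then x else y) 1 isT) _.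
  rewrite lee_fin big_ord1 /seg_bound /dotp big1 ?sqrtr0; last first.
    by move=> i; have := ltn_ord i; rewrite {2}d0.
  by rewrite !mulr_ge0 ?powR_ge0 ?sqrtr_ge0.
apply: le_trans (riem_dist_le Phi smP posP Omega D D0 _ _ diamOE x y) _.
- move=> z e e0; have [r r0 sub] := gradient_cube Phi smP z e e0.
  exact: (transport_image_adherent Omega _ trP z e r r0 sub).
- move=> w u Ow u1.
  exact: (exists_controlled_preimage Omega _ volO trP cvxO D diamOE w u d0 Ow u1).
rewrite lee_fin sqrtrM// (_ : 4^-1 = 2^-1 * 2^-1 :> R); last by field.
by rewrite powRrM !powR12_sqrt ?powR_ge0 ?sqrtr_ge0// mulrAC mulrA.
Qed.
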